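(* There is a computable instance of $\mathsf{DT}^2_{4,3}$ all of whose solutions compute the halting set $\emptyset'$.
   Context: The rationals $\mathbb Q$ are given by a fixed computable presentation. $\mathsf{DT}^n_{k,\ell}$ is the statement: for every $f:[\mathbb Q]^n\to k$ there is a dense suborder $S\subseteq\mathbb Q$ with no endpoints (i.e. $(S,<)$ is a dense linear order without endpoints) such that $|f([S]^n)|\le\ell$. As a problem, an instance is such a coloring $f$ and a solution is such a set $S$. Here $[X]^n$ is the set of $n$-element subsets of $X$. *)

(* Defs.v *)
From HB Require Import structures.
From mathcomp Require Import all_boot all_order all_algebra.
Set Implicit Arguments. Unset Strict Implicit. Unset Printing Implicit Defensive.
Import Order.TTheory GRing.Theory Num.Theory.

Inductive prog : Type :=
| PZero
| PSucc
| PProj (i : nat)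
| POracle
| PComp (f : prog) (gs : seq prog)
| PPrec (f g : prog)
| PMu (f : prog).

Inductive eval (A : nat -> bool) : prog -> seq nat -> nat -> Prop :=
| ev_zero v : eval A PZero v 0
| ev_succ x v : eval A PSucc (x :: v) x.+1
| ev_proj i v : i < size v -> eval A (PProj i) v (nth 0 v i)
| ev_oracle x v : eval A POracle (x :: v) (A x : nat)
| ev_comp f gs v ws y :
    evals A gs v ws -> eval A f ws y -> eval A (PComp f gs) v y
| ev_prec0 f g v y : eval A f v y -> eval A (PPrec f g) (0 :: v) y
| ev_precS f g n v z y :
    eval A (PPrec f g) (n :: v) z -> eval A g (n :: z :: v) y ->
    eval A (PPrec f g) (n.+1 :: v) y
| ev_mu f v n :
    eval A f (n :: v) 0 ->
    (forall m, m < n -> exists k, eval A f (m :: v) k.+1) ->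
    eval A (PMu f) v n
with evals (A : nat -> bool) : seq prog -> seq nat -> seq nat -> Prop :=
| evs_nil v : evals A [::] v [::]
| evs_cons g gs v w ws :
    eval A g v w -> evals A gs v ws -> evals A (g :: gs) v (w :: ws).

Fixpoint prog_enc (p : prog) : GenTree.tree nat :=
  match p with
  | PZero => GenTree.Node 0 [::]
  | PSucc => GenTree.Node 1 [::]
  | PProj i => GenTree.Node 2 [:: GenTree.Leaf i]
  | POracle => GenTree.Node 3 [::]
  | PComp f gs => GenTree.Node 4 (prog_enc f :: map prog_enc gs)
  | PPrec f g => GenTree.Node 5 [:: prog_enc f; prog_enc g]
  | PMu f => GenTree.Node 6 [:: prog_enc f]
  end.

Fixpoint prog_dec (t : GenTree.tree nat) : option prog :=
  match t with
  | GenTree.Node 0 [::] => Some PZero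
  | GenTree.Node 1 [::] => Some PSucc
  | GenTree.Node 2 [:: GenTree.Leaf i] => Some (PProj i)
  | GenTree.Node 3 [::] => Some POracle
  | GenTree.Node 4 (tf :: tgs) =>
      match prog_dec tf,
            foldr (fun t acc => match prog_dec t, acc with
                                | Some g, Some gs => Some (g :: gs)
                                | _, _ => None end) (Some [::]) tgs with
      | Some f, Some gs => Some (PComp f gs)
      | _, _ => None
      end
  | GenTree.Node 5 [:: tf; tg] =>
      match prog_dec tf, prog_dec tg with
      | Some f, Some g => Some (PPrec f g)
      | _, _ => None end
  | GenTree.Node 6 [:: tf] =>
      match prog_dec tf with Some f => Some (PMu f) | None => None end
  | _ => None
  end.

Fixpoint prog_encK (p : prog) : prog_dec (prog_enc p) = Some p :=
  match p return prog_dec (prog_enc p) = Some p with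
  | PZero => erefl
  | PSucc => erefl
  | PProj i => erefl
  | POracle => erefl
  | PComp f gs =>
      let fix aux (gs : seq prog) :
        foldr (fun t acc => match prog_dec t, acc with
                            | Some g, Some gs => Some (g :: gs)
                            | _, _ => None end) (Some [::]) (map prog_enc gs)
        = Some gs :=
        match gs with
        | [::] => erefl
        | g :: gs' => ltac:(simpl; rewrite (prog_encK g) (aux gs'); reflexivity)
        end in
      ltac:(simpl; rewrite (prog_encK f) aux; reflexivity)
  | PPrec f g => ltac:(simpl; rewrite (prog_encK f) (prog_encK g); reflexivity)
  | PMu f => ltac:(simpl; rewrite (prog_encK f); reflexivity)
  end.

HB.instance Definition _ := Countable.copy prog (pcan_type prog_encK).

Definition code (p : prog) : nat := pickle p.

Definition no_oracle : nat -> bool := fun _ => false.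

Definition halting_set (e : nat) : Prop :=
  exists p : prog, code p = e /\ exists y, eval no_oracle p [:: e] y.

Definition turing_computes (A : nat -> bool) (B : nat -> Prop) : Prop :=
  exists p : prog, forall n,
    (B n -> eval A p [:: n] 1) /\ (~ B n -> eval A p [:: n] 0).

(* Fixed computable presentation of Q: the rational q is coded by the
   natural number [pickle q] (MathComp's countType encoding of rat). *)
Definition qcode (q : rat) : nat := pickle q.

Definition rat_set_oracle (S : pred rat) : nat -> bool :=
  fun n => if (pickle_inv n : option rat) is Some q then S q else false.

(* A coloring of [Q]^2 with k colors: the color of the 2-element set {x, y}
   with x < y is f x y (values of f at x >= y are irrelevant). *)
Definition coloring2 (k : nat) := rat -> rat -> 'I_k.

Definition computable_coloring2 k (f : coloring2 k) : Prop :=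
  exists p : prog, forall x y : rat, (x < y)%R ->
    eval no_oracle p [:: qcode x; qcode y] (f x y : nat).

Definition dense_no_endpoints (S : pred rat) : Prop :=
  [/\ exists x, S x,
      (forall x y, S x -> S y -> (x < y)%R -> exists z, [/\ S z, (x < z)%R & (z < y)%R]) &
      (forall x, S x -> exists y z, [/\ S y, S z, (y < x)%R & (x < z)%R])].

Definition DT2_solution k (l : nat) (f : coloring2 k) (S : pred rat) : Prop :=
  dense_no_endpoints S /\
  exists C : {set 'I_k}, #|C| <= l /\
    (forall x y, S x -> S y -> (x < y)%R -> f x y \in C).

(* Main.v *)
Require Import Defs.
From mathcomp Require Import all_boot all_order all_algebra.
From mathcomp Require Import zify ring lra.
Set Implicit Arguments. Unset Strict Implicit. Unset Printing Implicit Defensive.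
Import Order.TTheory GRing.Theory Num.Theory.

(* Write |x| for the code of the rational x, m(x,y) for the integer part of 1/(y-x),
   and let K_s be the part of the halting set enumerated within s steps.  For x < y
   colour {x,y} by two bits: whether |x| < |y|, and whether K_|x| and K_|y| differ
   below m(x,y).  A solution S omits a colour, so for one value of the first bit the
   second bit is constant on S.

   It cannot be constantly "differ": if b < c in S, then m(x,y) <= m(b,c) whenever
   x < b < c < y, while |x| and |y| can be taken past the stage at which K settles
   below m(b,c).  So it is constantly "agree".  To decide n, search for x < y in S
   with m(x,y) > n, and let w be the endpoint which is to have the smaller code.  The
   points of S between x and y have arbitrarily large codes and are even closer to w,
   so n is in the halting set iff it is in K_|w|.

   The stages K_s come from an abstract machine running on coded configurations. *)

(** * Closure properties of the functions computable from an oracle *)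

Definition recursive (A : nat -> bool) (k : nat) (F : seq nat -> nat) : Prop :=
  exists p : prog, forall v, size v = k -> eval A p v (F v).

Notation recursiveb A k P := (recursive A k (fun v => nat_of_bool (P v))).
Notation recursive1 A g := (recursive A 1 (fun v => g (nth 0 v 0))).
Notation recursive2 A g :=
  (recursive A 2 (fun v => g (nth 0 v 0) (nth 0 v 1))).

Section Closure.
Variables (A : nat -> bool) (k : nat).
Implicit Types (F G N B : seq nat -> nat) (P Q : seq nat -> bool).

Lemma eq_recursive F G :
  (forall v, size v = k -> F v = G v) -> recursive A k F -> recursive A k G.
Proof. by move=> e [p hp]; exists p => v hv; rewrite -e //; apply: hp. Qed.

Lemma recursive_arg i : i < k -> recursive A k (fun v => nth 0 v i).
Proof. by move=> ik; exists (PProj i) => v hv; apply: ev_proj; rewrite hv. Qed.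

Lemma recursive_drop d i : d + i < k -> recursive A k (fun v => nth 0 (drop d v) i).
Proof.
move=> ik; apply: (eq_recursive _ (recursive_arg ik)) => v _.
by rewrite nth_drop.
Qed.

Lemma recursive_behead i : i.+1 < k -> recursive A k (fun v => nth 0 (behead v) i).
Proof.
move=> ik; apply: (eq_recursive _ (@recursive_drop 1 i ik)) => v _.
by rewrite drop1.
Qed.

Lemma recursive_app1 g F :
  recursive1 A g -> recursive A k F -> recursive A k (fun v => g (F v)).
Proof.
move=> [p hp] [q hq]; exists (PComp p [:: q]) => v hv.
apply: (@ev_comp _ _ _ _ [:: F v]); first by repeat constructor; apply: hq.
exact: (hp [:: F v]).
Qed.

Lemma recursive_app2 g F G :
  recursive2 A g -> recursive A k F -> recursive A k G ->
  recursive A k (fun v => g (F v) (G v)).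
Proof.
move=> [p hp] [q hq] [r hr]; exists (PComp p [:: q; r]) => v hv.
apply: (@ev_comp _ _ _ _ [:: F v; G v]).
  by repeat constructor; [apply: hq | apply: hr].
exact: (hp [:: F v; G v]).
Qed.

Lemma recursive_succ F : recursive A k F -> recursive A k (fun v => (F v).+1).
Proof.
by apply: recursive_app1; exists PSucc => -[|x [|? ?]] // _; apply: ev_succ.
Qed.

Lemma recursive_oracle F : recursive A k F -> recursiveb A k (fun v => A (F v)).
Proof.
apply: (recursive_app1 (g := fun x => nat_of_bool (A x))).
by exists POracle => -[|x [|? ?]] // _; apply: ev_oracle.
Qed.

Lemma recursive_const c : recursive A k (fun=> c).
Proof.
elim: c => [|c ih]; last exact: recursive_succ ih.
by exists PZero => v _; apply: ev_zero.
Qed.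

(** [PPrec] expects a counter in front of its parameters, so a loop has to hand on its own arguments
    by projections. The prefix [w] serves the induction. *)
Lemma evals_proj (v w : seq nat) : evals A (map PProj (iota (size w) (size v))) (w ++ v) v.
Proof.
elim: v w => [|x v ih] w /=; first by constructor.
constructor; last by have:= ih (rcons w x); rewrite size_rcons cat_rcons.
have:= @ev_proj A (size w) (w ++ x :: v).
by rewrite nth_cat ltnn subnn; apply; rewrite size_cat /= addnS ltnS leq_addr.
Qed.

Lemma recursive_iteri N B (S : nat -> nat -> seq nat -> nat) :
  recursive A k N -> recursive A k B ->
  recursive A k.+2 (fun w => S (nth 0 w 0) (nth 0 w 1) (drop 2 w)) ->
  recursive A k (fun v => iteri (N v) (fun n z => S n z v) (B v)).
Proof.
move=> [p hp] [q hq] [r hr].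
exists (PComp (PPrec q r) (p :: map PProj (iota 0 k))) => v hv.
apply: (@ev_comp _ _ _ _ (N v :: v)).
  constructor; first exact: hp.
  by have:= evals_proj v [::]; rewrite hv.
elim: (N v) => [|n ih] /=; first by constructor; apply: hq.
apply: ev_precS ih _.
have:= hr [:: n, iteri n (fun n z => S n z v) (B v) & v]; rewrite /= drop0.
by apply; rewrite hv.
Qed.

Lemma recursive_pred F : recursive A k F -> recursive A k (fun v => (F v).-1).
Proof.
move=> hF.
apply: (@eq_recursive (fun v => iteri (F v) (fun n z => n) 0)).
  by move=> v _; case: (F v).
apply: (recursive_iteri (S := fun n _ _ => n)) => //.
  exact: recursive_const.
by exists (PProj 0) => v hv; apply: ev_proj; rewrite hv.
Qed.

Lemma recursive_mu (R : nat -> seq nat -> bool) G :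
  recursiveb A k.+1 (fun w => R (nth 0 w 0) (behead w)) ->
  (forall v, size v = k -> R (G v) v /\ forall m, m < G v -> ~~ R m v) ->
  recursive A k G.
Proof.
move=> [p hp] h.
(* [PMu] searches for the value [0], whereas [R] is signalled by the value [1]. *)
pose inv := PPrec (PComp PSucc [:: PZero]) PZero.
have einv (b : bool) : eval A inv [:: (b : nat)] (~~ b).
  case: b => /=; last first.
    by constructor; apply: (@ev_comp _ _ _ _ [:: 0]); repeat constructor.
  apply: (ev_precS (z := 1)); last by constructor.
  by constructor; apply: (@ev_comp _ _ _ _ [:: 0]); repeat constructor.
have ev m v : size v = k -> eval A (PComp inv [:: p]) (m :: v) (~~ R m v).
  move=> hv; apply: (@ev_comp _ _ _ _ [:: (R m v : nat)]); last exact: einv.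
  by repeat constructor; apply: (hp (m :: v)); rewrite /= hv.
exists (PMu (PComp inv [:: p])) => v hv.
have [h1 h2] := h v hv; constructor; first by have:= ev (G v) v hv; rewrite h1.
by move=> m /h2 h3; exists 0; have:= ev m v hv; rewrite h3.
Qed.

End Closure.

Section Arithmetic.
Variables (A : nat -> bool) (k : nat).
Implicit Types (F G N B : seq nat -> nat) (P Q : seq nat -> bool).

Lemma recursive_add F G : recursive A k F -> recursive A k G ->
  recursive A k (fun v => F v + G v).
Proof.
move=> hF hG.
apply: (@eq_recursive _ _ (fun v => iteri (G v) (fun n z => z.+1) (F v))).
  by move=> v _; elim: (G v) => [|n ih] /=; rewrite ?ih; lia.
apply: (recursive_iteri (S := fun _ z _ => z.+1)) => //.
by apply: recursive_succ; apply: recursive_arg.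
Qed.

Lemma recursive_sub F G : recursive A k F -> recursive A k G ->
  recursive A k (fun v => F v - G v).
Proof.
move=> hF hG.
apply: (@eq_recursive _ _ (fun v => iteri (G v) (fun n z => z.-1) (F v))).
  by move=> v _; elim: (G v) => [|n ih] /=; rewrite ?ih; lia.
apply: (recursive_iteri (S := fun _ z _ => z.-1)) => //.
by apply: recursive_pred; apply: recursive_arg.
Qed.

End Arithmetic.

Section Decisions.
Variables (A : nat -> bool) (k : nat).
Implicit Types (F G N B : seq nat -> nat) (P Q : seq nat -> bool).

Lemma recursive_mul F G : recursive A k F -> recursive A k G ->
  recursive A k (fun v => F v * G v).
Proof.
apply: recursive_app2.
apply: (@eq_recursive _ _ (fun v => iteri (nth 0 v 1) (fun n z => z + nth 0 v 0) 0)).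
  by move=> v _; elim: (nth 0 v 1) => [|n ih] /=; rewrite ?ih; lia.
apply: (recursive_iteri (S := fun _ z v => z + nth 0 v 0)).
- exact: recursive_arg.
- exact: recursive_const.
- by apply: recursive_add; [apply: recursive_arg | apply: recursive_drop].
Qed.

Lemma recursiveb_eq0 F : recursive A k F -> recursiveb A k (fun v => F v == 0).
Proof.
move=> hF; apply: (@eq_recursive _ _ (fun v => 1 - F v)); first by move=> v _; lia.
by apply: recursive_sub => //; apply: recursive_const.
Qed.

Lemma recursiveb_leq F G : recursive A k F -> recursive A k G ->
  recursiveb A k (fun v => F v <= G v).
Proof. by move=> hF hG; apply: recursiveb_eq0; apply: recursive_sub. Qed.

Lemma recursiveb_eq F G : recursive A k F -> recursive A k G ->
  recursiveb A k (fun v => F v == G v).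
Proof.
move=> hF hG.
apply: (@eq_recursive _ _ (fun v => (F v - G v) + (G v - F v) == 0)).
  by move=> v _; congr nat_of_bool; lia.
by apply: recursiveb_eq0; apply: recursive_add; apply: recursive_sub.
Qed.

Lemma recursiveb_not P : recursiveb A k P -> recursiveb A k (fun v => ~~ P v).
Proof.
move=> /recursiveb_eq0; apply: eq_recursive => v _.
by case: (P v).
Qed.

Lemma recursiveb_and P Q : recursiveb A k P -> recursiveb A k Q ->
  recursiveb A k (fun v => P v && Q v).
Proof.
move=> hP hQ; apply: eq_recursive (recursive_mul hP hQ) => v _.
by case: (P v); case: (Q v).
Qed.

Lemma recursiveb_or P Q : recursiveb A k P -> recursiveb A k Q ->
  recursiveb A k (fun v => P v || Q v).
Proof.
move=> /recursiveb_not hP /recursiveb_not hQ.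
apply: eq_recursive (recursiveb_not (recursiveb_and hP hQ)) => v _.
by case: (P v); case: (Q v).
Qed.

Lemma recursive_if P F G :
  recursiveb A k P -> recursive A k F -> recursive A k G ->
  recursive A k (fun v => if P v then F v else G v).
Proof.
move=> hP hF hG.
apply: (@eq_recursive _ _ (fun v => P v * F v + ~~ P v * G v)).
  by move=> v _; case: (P v); lia.
by apply: recursive_add; apply: recursive_mul => //; apply: recursiveb_not.
Qed.

End Decisions.

Ltac rec_base :=
  match goal with
  | |- recursive _ _ (fun v => nth 0 v _) => apply: recursive_arg; done
  | |- recursive _ _ (fun v => nth 0 (drop _ v) _) => apply: recursive_drop; done
  | |- recursive _ _ (fun v => nth 0 (behead v) _) => apply: recursive_behead; done
  | |- recursive _ _ (fun v => nat_of_bool (_ == _)) => apply: recursiveb_eq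
  | |- recursive _ _ (fun v => nat_of_bool (_ <= _)) => apply: recursiveb_leq
  | |- recursive _ _ (fun v => nat_of_bool (~~ _)) => apply: recursiveb_not
  | |- recursive _ _ (fun v => nat_of_bool (_ && _)) => apply: recursiveb_and
  | |- recursive _ _ (fun v => nat_of_bool (_ || _)) => apply: recursiveb_or
  | |- recursive _ _ (fun v => if _ then _ else _) => apply: recursive_if
  | |- recursive _ _ (fun v => _ + _) => apply: recursive_add
  | |- recursive _ _ (fun v => _ - _) => apply: recursive_sub
  | |- recursive _ _ (fun v => _ * _) => apply: recursive_mul
  | |- recursive _ _ (fun v => _.+1) => apply: recursive_succ
  | |- recursive _ _ (fun v => _.-1) => apply: recursive_pred
  | |- recursive _ _ (fun _ => ?c) => apply: recursive_const
  end.
Ltac rec_user := fail.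
Ltac rec := repeat first [progress rec_user | rec_base].

Section Division.
Variables (A : nat -> bool) (k : nat).
Implicit Types (F G N B : seq nat -> nat) (P Q : seq nat -> bool).

Lemma recursive_exp2 F : recursive A k F -> recursive A k (fun v => 2 ^ F v).
Proof.
move=> hF; apply: (@eq_recursive _ _ (fun v => iteri (F v) (fun n z => 2 * z) 1)).
  by move=> v _; elim: (F v) => [|n /= ->]; rewrite ?expnS.
by apply: (recursive_iteri (S := fun _ z _ => 2 * z)) => //; rec.
Qed.

Lemma recursive_div F G : recursive A k F -> recursive A k G ->
  recursive A k (fun v => F v %/ G v).
Proof.
apply: recursive_app2.
(* The quotient of [a] by [b] is the least [n] with [a < n.+1 * b]. The second disjunct stops the
   search at [0] when [b = 0], where [%/] has value [0]. *)
apply: (recursive_mu (R := fun n v => (nth 0 v 0 < n.+1 * nth 0 v 1) || (nth 0 v 1 == 0))).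
  by rec.
move=> v _; move: (nth 0 v 0) (nth 0 v 1) => a [|b]; first by rewrite divn0 orbT.
rewrite orbF ltn_ceil //; split=> // m hm; rewrite orbF -leqNgt.
by rewrite -leq_divRL.
Qed.

End Division.

(** * Pairs and lists coded as natural numbers *)

(* Each natural number is [0] or [ccons a b] for a unique pair [(a, b)], so that
   numbers double as S-expressions; [ccons a (ccode s)] is
   [CodeSeq.code (a :: s)]. *)
Definition ccons a b := 2 ^ a * b.*2.+1.
Definition chd x := logn 2 x.
Definition ctl x := (x %/ 2 ^ logn 2 x) %/ 2.

Notation ccode := CodeSeq.code.

Lemma ccode_cons a s : ccode (a :: s) = ccons a (ccode s).
Proof. by []. Qed.

Lemma ccons_neq0 a b : (ccons a b == 0) = false.
Proof. by rewrite /ccons muln_eq0 expn_eq0. Qed.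

Lemma chd_ccons a b : chd (ccons a b) = a.
Proof.
rewrite /chd /ccons lognM ?expn_gt0 // pfactorK // [logn 2 _]lognE.
by rewrite dvdn2 oddS odd_double /= addn0.
Qed.

Lemma ctl_ccons a b : ctl (ccons a b) = b.
Proof.
rewrite /ctl -/(chd _) chd_ccons /ccons mulKn ?expn_gt0 //.
by rewrite divn2 /= uphalf_double.
Qed.

Lemma ccons_inj a b a' b' : ccons a b = ccons a' b' -> a = a' /\ b = b'.
Proof.
move=> e; split; first by rewrite -[a](chd_ccons a b) e chd_ccons.
by rewrite -[b](ctl_ccons a b) e ctl_ccons.
Qed.

Lemma chd0 : chd 0 = 0. Proof. by []. Qed.
Lemma ctl0 : ctl 0 = 0. Proof. by []. Qed.

Definition cE := (chd_ccons, ctl_ccons, ccons_neq0, chd0, ctl0).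

Section Coding.
Variables (A : nat -> bool) (k : nat).
Implicit Types (F G N B : seq nat -> nat) (P Q : seq nat -> bool).

Lemma recursive_ccons F G : recursive A k F -> recursive A k G ->
  recursive A k (fun v => ccons (F v) (G v)).
Proof.
move=> hF hG.
apply: (@eq_recursive _ _ (fun v => 2 ^ F v * (2 * G v).+1)).
  by move=> v _; rewrite /ccons mul2n.
by rec => //; apply: recursive_exp2.
Qed.

Lemma recursive_chd F : recursive A k F -> recursive A k (fun v => chd (F v)).
Proof.
apply: recursive_app1.
(* [logn 2 x] is the least [n] such that [2 ^ n.+1] does not divide [x]; the second disjunct covers
   [x = 0], where [logn] is [0]. *)
apply: (recursive_mu (R := fun n v => ~~ (nth 0 v 0 %/ 2 ^ n.+1 * 2 ^ n.+1 == nth 0 v 0)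
    || (nth 0 v 0 == 0))).
  rec; try (by apply: recursive_exp2; rec).
  by apply: recursive_div; rec; apply: recursive_exp2; rec.
move=> v _; move: (nth 0 v 0) => x; rewrite /chd.
have [->|x0] := eqVneq x 0; first by rewrite orbT logn0.
have e n : (x %/ 2 ^ n.+1 * 2 ^ n.+1 == x) = (n < logn 2 x).
  by rewrite -dvdn_eq pfactor_dvdn // lt0n.
by rewrite orbF e ltnn; split=> // m hm; rewrite orbF e hm.
Qed.

Lemma recursive_ctl F : recursive A k F -> recursive A k (fun v => ctl (F v)).
Proof.
move=> hF; do 2! [apply: recursive_div; rec => //].
by apply: recursive_exp2; apply: recursive_chd.
Qed.

End Coding.

(* Otherwise [simpl] evaluates comparisons of closed codes in unary. *)
#[global] Opaque ccons chd ctl.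
#[global] Arguments CodeSeq.code : simpl never.

Ltac rec_user ::=
  match goal with
  | |- recursive _ _ (fun v => ccons _ _) => apply: recursive_ccons
  | |- recursive _ _ (fun v => chd _) => apply: recursive_chd
  | |- recursive _ _ (fun v => ctl _) => apply: recursive_ctl
  | |- recursive _ _ (fun v => _ %/ _) => apply: recursive_div
  end.

(** A state pairs the accumulator with the rest of the list. It is stationary once the list is
    exhausted, so a fold may run for as many rounds as the code of the list, which bounds its
    length. *)
Definition cfold_step (f : nat -> nat -> nat) st :=
  if ctl st == 0 then st
  else ccons (f (chd st) (chd (ctl st))) (ctl (ctl st)).
Definition cfoldl f z x := chd (iteri x (fun _ => cfold_step f) (ccons z x)).
Definition crev x := cfoldl (fun acc a => ccons a acc) 0 x.
Definition cfoldr f z x := cfoldl (fun acc a => f a acc) z (crev x).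
Definition cdrop i x := iteri i (fun _ z => ctl z) x.

Lemma size_code s : size s <= CodeSeq.code s.
Proof.
elim: s => //= a s ih; apply: leq_trans (leq_pmull _ (expn_gt0 2 a)).
by rewrite ltnS (leq_trans ih) // -addnn leq_addr.
Qed.

Lemma cfoldl_code f z s : cfoldl f z (ccode s) = foldl f z s.
Proof.
rewrite /cfoldl; move: {1 2}(ccode s) (size_code s) => n.
have iterSr m g x : iteri m.+1 (fun _ => g) x = iteri m (fun _ => g) (g x) :> nat.
  by elim: m => //= m <-.
have stop m w : chd (iteri m (fun _ => cfold_step f) (ccons w 0)) = w.
  elim: m => [|m ih]; first by rewrite chd_ccons.
  by rewrite iterSr {2}/cfold_step !cE eqxx.
elim: s z n => [|a s ih] z n; first by rewrite stop.
case: n => // n; rewrite ltnS => hn; rewrite iterSr {2}/cfold_step.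
by rewrite ccode_cons !cE ih.
Qed.

Lemma crev_code s : crev (ccode s) = CodeSeq.code (rev s).
Proof.
rewrite /crev cfoldl_code -[s in RHS]revK revK; elim/last_ind: s => //= s x ih.
by rewrite foldl_rcons ih rev_rcons.
Qed.

Lemma cfoldr_code f z s : cfoldr f z (ccode s) = foldr f z s.
Proof. by rewrite /cfoldr crev_code cfoldl_code foldl_rev. Qed.

Lemma cdrop_code i s : cdrop i (ccode s) = CodeSeq.code (drop i s).
Proof.
elim: i => [|i ih]; first by rewrite drop0.
rewrite /cdrop /= -/(cdrop i _) ih -addn1 addnC -drop_drop drop1.
by case: (drop i s) => // a t; rewrite ccode_cons ctl_ccons.
Qed.

Section CodedLists.
Variables (A : nat -> bool) (k : nat).
Implicit Types (F G N B : seq nat -> nat).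

Lemma recursive_cfoldl f z F : recursive2 A f -> recursive A k F ->
  recursive A k (fun v => cfoldl f z (F v)).
Proof.
move=> hf; apply: recursive_app1; apply: recursive_chd.
apply: (recursive_iteri (S := fun _ st _ => cfold_step f st)); rec.
by rewrite /cfold_step; rec; apply: (recursive_app2 hf); rec.
Qed.

Lemma recursive_cfoldr f z F : recursive2 A f -> recursive A k F ->
  recursive A k (fun v => cfoldr f z (F v)).
Proof.
move=> hf hF; apply: recursive_cfoldl; last by apply: recursive_cfoldl; rec.
by apply: (recursive_app2 hf); rec.
Qed.

Lemma recursive_cdrop F G : recursive A k F -> recursive A k G ->
  recursive A k (fun v => cdrop (F v) (G v)).
Proof.
move=> hF hG; apply: (recursive_iteri (S := fun _ z _ => ctl z)) => //.
by rec.
Qed.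

End CodedLists.

(** * An abstract machine for programs without oracle *)

(** The tree [prog_enc p] as an S-expression, labels raised by one: the head [0] is left to mark a
    leaf, the argument of [PProj]. *)
Fixpoint pcode (p : prog) : nat :=
  match p with
  | PZero => ccons 1 0
  | PSucc => ccons 2 0
  | PProj i => ccons 3 (ccons (ccons 0 i) 0)
  | POracle => ccons 4 0
  | PComp f gs => ccons 5 (ccons (pcode f) (ccode (map pcode gs)))
  | PPrec f g => ccons 6 (ccons (pcode f) (ccons (pcode g) 0))
  | PMu f => ccons 7 (ccons (pcode f) 0)
  end.

(* Configurations of an abstract machine: evaluate the program [p] on [v], evaluate
   the list of programs [gs] on [v], or return [y] to the stack of frames [K]. *)
Definition sEval p v K := ccons 1 (ccons p (ccons v K)).
Definition sList gs v K := ccons 2 (ccons gs (ccons v K)).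
Definition sRet y K := ccons 3 (ccons y K).

(** What awaits a returned value: a program to apply to it, further arguments to evaluate, an
    earlier value to put in front of it, the next round of a recursion, or the test of the candidate
    [n] in a search. *)
Definition fApply f := ccons 1 f.
Definition fArgs gs v := ccons 2 (ccons gs v).
Definition fCons w := ccons 3 w.
Definition fPrec g n v := ccons 4 (ccons g (ccons n v)).
Definition fMu f n v := ccons 5 (ccons f (ccons n v)).

(* The value [0] is a stuck configuration. *)
Definition step_eval p v K :=
  if chd p == 1 then sRet 0 K else
  if chd p == 2 then (if v == 0 then 0 else sRet (chd v).+1 K) else
  if chd p == 3 then
    (if cdrop (ctl (chd (ctl p))) v == 0 then 0
     else sRet (chd (cdrop (ctl (chd (ctl p))) v)) K) else
  if chd p == 4 then (if v == 0 then 0 else sRet 0 K) else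
  if chd p == 5 then sList (ctl (ctl p)) v (ccons (fApply (chd (ctl p))) K) else
  if chd p == 6 then
    (if v == 0 then 0 else
     if chd v == 0 then sEval (chd (ctl p)) (ctl v) K else
     sEval p (ccons (chd v).-1 (ctl v))
       (ccons (fPrec (chd (ctl (ctl p))) (chd v).-1 (ctl v)) K)) else
  if chd p == 7 then
    sEval (chd (ctl p)) (ccons 0 v) (ccons (fMu (chd (ctl p)) 0 v) K)
  else 0.

Definition step_list gs v K :=
  if gs == 0 then sRet 0 K else sEval (chd gs) v (ccons (fArgs (ctl gs) v) K).

(** A return to the empty stack is a fixed point, so a halted run stays halted at all later
    times. *)
Definition step_ret y K :=
  if K == 0 then sRet y K else
  if chd (chd K) == 1 then sEval (ctl (chd K)) y (ctl K) else
  if chd (chd K) == 2 then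
    sList (chd (ctl (chd K))) (ctl (ctl (chd K))) (ccons (fCons y) (ctl K)) else
  if chd (chd K) == 3 then sRet (ccons (ctl (chd K)) y) (ctl K) else
  if chd (chd K) == 4 then
    sEval (chd (ctl (chd K)))
      (ccons (chd (ctl (ctl (chd K)))) (ccons y (ctl (ctl (ctl (chd K)))))) (ctl K) else
  if chd (chd K) == 5 then
    (if y == 0 then sRet (chd (ctl (ctl (chd K)))) (ctl K) else
     sEval (chd (ctl (chd K)))
       (ccons (chd (ctl (ctl (chd K)))).+1 (ctl (ctl (ctl (chd K)))))
       (ccons (fMu (chd (ctl (chd K))) (chd (ctl (ctl (chd K)))).+1
                 (ctl (ctl (ctl (chd K))))) (ctl K)))
  else 0.

Definition step s :=
  if chd s == 1 then
    step_eval (chd (ctl s)) (chd (ctl (ctl s))) (ctl (ctl (ctl s))) else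
  if chd s == 2 then
    step_list (chd (ctl s)) (chd (ctl (ctl s))) (ctl (ctl (ctl s))) else
  if chd s == 3 then step_ret (chd (ctl s)) (ctl (ctl s)) else 0.

Definition halted s := (chd s == 3) && (ctl (ctl s) == 0).

Lemma recursive_step A k F : recursive A k F -> recursive A k (fun v => step (F v)).
Proof.
apply: recursive_app1; rewrite /step /step_eval /step_list /step_ret.
rewrite /sEval /sList /sRet /fApply /fArgs /fCons /fPrec /fMu.
by rec; apply: recursive_cdrop; rec.
Qed.

Lemma step_sEval p v K : step (sEval p v K) = step_eval p v K.
Proof. by rewrite /step /sEval !cE. Qed.

Lemma step_sList gs v K : step (sList gs v K) = step_list gs v K.
Proof. by rewrite /step /sList !cE. Qed.

Lemma step_sRet y K : step (sRet y K) = step_ret y K.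
Proof. by rewrite /step /sRet !cE. Qed.

Lemma step_proj i v K : step_eval (pcode (PProj i)) (ccode v) K =
  if i < size v then sRet (nth 0 v i) K else 0.
Proof.
rewrite /step_eval /= !cE /= cdrop_code.
case: ltnP => hi; last by rewrite drop_oversize.
by rewrite (drop_nth 0 hi) ccode_cons !cE.
Qed.

Definition sE := (step_sEval, step_sList, step_sRet, step_proj, ccode_cons).

Definition reaches s t := exists n, iter n step s = t.

Lemma reaches_step s t : reaches (step s) t -> reaches s t.
Proof. by case=> n <-; exists n.+1; rewrite iterSr. Qed.

Lemma reaches_trans s t u : reaches s t -> reaches t u -> reaches s u.
Proof. by move=> [n <-] [m <-]; exists (m + n); rewrite iterD. Qed.

Lemma reaches_refl s : reaches s s.
Proof. by exists 0. Qed.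

(** Mutual induction on derivations. The stack is arbitrary because subcomputations run on top of
    the frames pushed for them. *)
Fixpoint eval_reaches p v y (h : eval no_oracle p v y) {struct h} :
  forall K, reaches (sEval (pcode p) (ccode v) K) (sRet y K)
with evals_reaches gs v ws (h : evals no_oracle gs v ws) {struct h} :
  forall K, reaches (sList (ccode (map pcode gs)) (ccode v) K) (sRet (ccode ws) K).
Proof.
- case: p v y / h.
  + move=> v K; apply: reaches_step; rewrite sE /step_eval /= !cE /=.
    exact: reaches_refl.
  + move=> x v K; apply: reaches_step.
    rewrite !sE /step_eval /= !cE /=.
    exact: reaches_refl.
  + move=> i v hi K; apply: reaches_step; rewrite !sE hi.
    exact: reaches_refl.
  (* The machine answers every query by [0], as [no_oracle] does. *)
  + move=> x v K; apply: reaches_step.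
    rewrite !sE /step_eval /= !cE /=.
    exact: reaches_refl.
  + move=> f gs v ws y hgs hf K; apply: reaches_step.
    rewrite !sE /step_eval /= !cE /=.
    apply: reaches_trans (evals_reaches _ _ _ hgs _) _.
    apply: reaches_step; rewrite !sE /step_ret !cE /=.
    exact: eval_reaches hf _.
  + move=> f g v y hf K; apply: reaches_step.
    rewrite !sE /step_eval /= !cE /=.
    exact: eval_reaches hf _.
  + move=> f g n v z y hz hy K; apply: reaches_step.
    rewrite !sE /step_eval /= !cE /=.
    apply: reaches_trans (eval_reaches _ _ _ hz _) _.
    apply: reaches_step; rewrite !sE /step_ret !cE /=.
    exact: eval_reaches hy _.
  + move=> f v n h0 hm K; apply: reaches_step.
    rewrite !sE /step_eval /= !cE /=.
    (* The search arrives at each candidate up to [n], since all earlier ones give nonzero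
       values. *)
    have loop : forall i, i <= n ->
        reaches (sEval (pcode f) (ccons 0 (ccode v)) (ccons (fMu (pcode f) 0 (ccode v)) K))
          (sEval (pcode f) (ccons i (ccode v)) (ccons (fMu (pcode f) i (ccode v)) K)).
      elim=> [|i ih] hi; first exact: reaches_refl.
      apply: reaches_trans (ih (ltnW hi)) _.
      case: (hm i hi) => m hi'.
      apply: reaches_trans (eval_reaches _ _ _ hi' _) _.
      apply: reaches_step; rewrite !sE /step_ret !cE /=.
      exact: reaches_refl.
    apply: reaches_trans (loop n (leqnn n)) _.
    apply: reaches_trans (eval_reaches _ _ _ h0 _) _.
    apply: reaches_step; rewrite !sE /step_ret !cE /=.
    exact: reaches_refl.
- case: gs v ws / h.
  + move=> v K; apply: reaches_step; rewrite !sE /step_list /=.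
    exact: reaches_refl.
  + move=> g gs v w ws hg hgs K; apply: reaches_step.
    rewrite !sE /step_list !cE.
    apply: reaches_trans (eval_reaches _ _ _ hg _) _.
    apply: reaches_step; rewrite !sE /step_ret !cE /=.
    apply: reaches_trans (evals_reaches _ _ _ hgs _) _.
    apply: reaches_step; rewrite !sE /step_ret !cE /=.
    exact: reaches_refl.
Qed.

Lemma iter_step0 n : iter n step 0 = 0.
Proof. by elim: n => //= n ->. Qed.

Lemma halted_sEval p v K : halted (sEval p v K) = false.
Proof. by rewrite /halted !cE. Qed.

Lemma halted_sList p v K : halted (sList p v K) = false.
Proof. by rewrite /halted !cE. Qed.

Lemma halted_sRet y K : halted (sRet y K) = (K == 0).
Proof. by rewrite /halted !cE. Qed.

Lemma halted_iterS m s : ~~ halted s -> halted (iter m step s) ->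
  exists2 m', m' < m & halted (iter m' step (step s)).
Proof. by case: m => [/negP//|m] _; rewrite iterSr; exists m. Qed.

(** Strong induction on the length of the run: to halt, the machine must at some point return a
    value to [K], and what is left of the run is short enough for the induction hypothesis to apply
    to the next subcomputation. *)
Lemma halted_eval n :
  (forall p v K, halted (iter n step (sEval (pcode p) (ccode v) K)) ->
    exists y m, [/\ m <= n, eval no_oracle p v y & halted (iter m step (sRet y K))]) /\
  (forall gs v K, halted (iter n step (sList (ccode (map pcode gs)) (ccode v) K)) ->
    exists ws m, [/\ m <= n, evals no_oracle gs v ws
                   & halted (iter m step (sRet (ccode ws) K))]).
Proof.
elim/ltn_ind: n => n IH.
have IHe m p v K : m < n -> halted (iter m step (sEval (pcode p) (ccode v) K)) ->
    exists y m', [/\ m' <= m, eval no_oracle p v y & halted (iter m' step (sRet y K))].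
  by move=> /IH[h _] /h.
have IHl m gs v K : m < n ->
    halted (iter m step (sList (ccode (map pcode gs)) (ccode v) K)) ->
    exists ws m', [/\ m' <= m, evals no_oracle gs v ws
                    & halted (iter m' step (sRet (ccode ws) K))].
  by move=> /IH[_ h] /h.
(* Returning to a nonempty stack is not yet halting, so it consumes a step. *)
have pop m y fr K : halted (iter m step (sRet y (ccons fr K))) ->
    exists2 m', m' < m & halted (iter m' step (step_ret y (ccons fr K))).
  by move=> /halted_iterS; rewrite halted_sRet cE sE; apply.
have stuck m : halted (iter m step 0) -> False by rewrite iter_step0.
split.
- move=> p v K /halted_iterS; rewrite halted_sEval => /(_ isT)[m hm].
  rewrite step_sEval; case: p => [||i||f gs|f g|f].
  + rewrite /step_eval /= !cE /= => h.
    by exists 0, m; split=> //; [lia | constructor].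
  + rewrite /step_eval /= !cE /=; case: v => [/stuck//|x v].
    rewrite !sE !cE => h.
    by exists x.+1, m; split=> //; [lia | constructor].
  + rewrite sE; case: ltnP => [hi h|_ /stuck//].
    by exists (nth 0 v i), m; split=> //; [lia | constructor].
  + rewrite /step_eval /= !cE /=; case: v => [/stuck//|x v].
    rewrite !sE !cE => h.
    by exists 0, m; split=> //; [lia | exact: (ev_oracle no_oracle)].
  + rewrite /step_eval /= !cE /= => /IHl[|ws [m1 [h1 e1 /pop[m2 h2]]]] //.
    rewrite /step_ret !cE /= => /IHe[|y [m3 [h3 e3 h4]]]; first by lia.
    by exists y, m3; split=> //; [lia | exact: ev_comp e1 e3].
  + rewrite /step_eval /= !cE /=; case: v => [/stuck//|[|x] v].
      rewrite !sE !cE /= => /IHe[|y [m1 [h1 e1 h2]]] //.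
      by exists y, m1; split=> //; [lia | constructor].
    rewrite !sE !cE /= -!ccode_cons.
    move=> /(@IHe m (PPrec f g))[|z [m1 [h1 e1 /pop[m2 h2]]]] //.
    rewrite /step_ret !cE /= => /(@IHe m2 g [:: x, z & v])[|y [m3 [h3 e3 h4]]]; first by lia.
    by exists y, m3; split=> //; [lia | exact: ev_precS e1 e3].
  + rewrite /step_eval /= !cE /=.
    (* A second induction on the remaining run follows the search through its candidates; the last
       premise records that those before [i] failed. *)
    have loop m1 i : m1 < n ->
       halted (iter m1 step (sEval (pcode f) (ccons i (ccode v))
         (ccons (fMu (pcode f) i (ccode v)) K))) ->
       (forall j, j < i -> exists k, eval no_oracle f (j :: v) k.+1) ->
       exists y m', [/\ m' <= m1, eval no_oracle (PMu f) v y
                      & halted (iter m' step (sRet y K))].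
      elim/ltn_ind: m1 i => m1 ihm i hm1.
      move=> /(@IHe m1 f (i :: v))[|[|z] [m2 [h2 e2 /pop[m3 h3]]]] //.
        rewrite /step_ret !cE /= => h4 hj.
        by exists i, m3; split=> //; [lia | constructor].
      rewrite /step_ret !cE /= => h4 hj.
      have [|||y [m4 [h5 e5 h6]]] := ihm m3 _ i.+1 _ h4; try by lia.
        move=> j; rewrite ltnS leq_eqVlt => /orP[/eqP->|/hj//].
        by exists z.
      by exists y, m4; split=> //; lia.
    move=> /loop[|//|y [m' [h1 e1 h2]]] //.
    by exists y, m'; split=> //; lia.
- move=> gs v K /halted_iterS; rewrite halted_sList => /(_ isT)[m hm].
  rewrite step_sList /step_list; case: gs => [|g gs].
    by rewrite /= => h; exists [::], m; split=> //; [lia | constructor].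
  rewrite map_cons !sE !cE => /IHe[|w [m1 [h1 e1 /pop[m2 h2]]]] //.
  rewrite /step_ret !cE /= => /IHl[|ws [m3 [h3 e3 /pop[m4 h4]]]]; first by lia.
  rewrite /step_ret !cE /= => h5.
  by exists (w :: ws), m4; split=> //; [lia | constructor].
Qed.

Lemma eval_haltedP p v :
  (exists y, eval no_oracle p v y) <->
  (exists n, halted (iter n step (sEval (pcode p) (ccode v) 0))).
Proof.
split=> [[y /eval_reaches/(_ 0)[n hn]]|[n /(halted_eval n).1[y [m [_ h _]]]]].
  by exists n; rewrite hn halted_sRet.
by exists y.
Qed.

Lemma halted_iter m n s : m <= n -> halted (iter m step s) -> halted (iter n step s).
Proof.
move=> /subnK <- h; rewrite iterD; elim: (n - m) => //= d.
move: (iter d _ _) => t /andP[/eqP h1 /eqP h2].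
by rewrite /step h1 /= h2 /step_ret halted_sRet.
Qed.

(** * Recognising and parsing the codes of programs *)

(** [pickle] codes an element of a sum as a list of two options, each option being a list with at
    most one entry. *)
Definition cinl n := ccons (ccons n 0) (ccons 0 0).
Definition cinr n := ccons 0 (ccons (ccons n 0) 0).

Lemma pickle_inl n : pickle (inl n : nat + nat) = cinl n.
Proof. by []. Qed.

Lemma pickle_inr n : pickle (inr n : nat + nat) = cinr n.
Proof. by []. Qed.

Lemma code_prog p : code p = ccode (map pickle (GenTree.encode (prog_enc p))).
Proof. by []. Qed.

Definition uncinl t := chd (chd t).
Definition uncinr t := chd (chd (ctl t)).

(** As leaves have head [0], this says that no entry of [ts] is a leaf. *)
Definition call_nodes ts :=
  cfoldr (fun t acc => nat_of_bool ((acc == 1) && ~~ (chd t == 0))) 1 ts == 1.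

(* The tree with root label [n] and children [ts] encodes a program; a child is a leaf
   exactly when its head is [0]. *)
Definition cwf n ts :=
  ((n == 0) || (n == 1) || (n == 3)) && (ts == 0)
  || (n == 2) && (ts == ccons (ccons 0 (ctl (chd ts))) 0)
  || (n == 4) && (~~ (ts == 0) && call_nodes ts)
  || (n == 5) && (~~ (chd (chd ts) == 0) && ~~ (chd (chd (ctl ts)) == 0)
                  && (ctl (ctl ts) == 0))
  || (n == 6) && (~~ (chd (chd ts) == 0) && (ctl ts == 0)).

(* [GenTree.decode_step] on codes, with result [0] as soon as the input is not the
   encoding of a program. *)
Definition parse_step t st :=
  if st == 0 then 0 else
  if t == cinr (uncinr t) then
    ccons (ccons (ccons 0 (uncinr t)) (chd st)) (ctl st) else
  if t == cinl (uncinl t) then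
    (if uncinl t == 0 then ccons 0 st else
     if ctl st == 0 then 0 else
     if cwf (uncinl t).-1 (chd st) then
       ccons (ccons (ccons (uncinl t) (chd st)) (chd (ctl st))) (ctl (ctl st))
     else 0)
  else 0.

(** The input is read from its right end. The stack holds the lists of finished siblings, innermost
    first: an end marker [inl 0] opens a list, and a label takes the top list as its children.
    Success leaves a single list with a single tree. *)
Definition parse e := cfoldr parse_step (ccons 0 0) e.
Definition parsed e := chd (chd (parse e)).
Definition valid e := (parse e == ccons (ccons (parsed e) 0) 0) && ~~ (chd (parsed e) == 0).

Section Parsing.
Variables (A : nat -> bool) (k : nat).
Implicit Types (F G : seq nat -> nat).

Lemma recursive_parse F : recursive A k F -> recursive A k (fun v => parse (F v)).
Proof.
apply: recursive_cfoldr.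
rewrite /parse_step /cwf /cinl /cinr /uncinl /uncinr.
rec; apply: recursiveb_eq; rec; apply: recursive_cfoldr; rec.
Qed.

Lemma recursive_parsed F : recursive A k F -> recursive A k (fun v => parsed (F v)).
Proof. by move=> hF; rewrite /parsed; rec; apply: recursive_parse. Qed.

Lemma recursive_valid F : recursive A k F -> recursiveb A k (fun v => valid (F v)).
Proof.
move=> hF; rewrite /valid.
by rec; (apply: recursive_parse || apply: recursive_parsed).
Qed.

End Parsing.

(* A child in the encoding of a program: the argument of [PProj] or a program. *)
Notation item := (nat + prog)%type.
Definition icode (x : item) := match x with inl i => ccons 0 i | inr p => pcode p end.
Definition ienc (x : item) : seq (nat + nat) :=
  match x with inl i => [:: inr i] | inr p => GenTree.encode (prog_enc p) end.
Definition iencs I := flatten (map ienc I).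
Notation icodes I := (ccode (map icode I)).

Lemma chd_pcode p : (chd (pcode p) == 0) = false.
Proof. by case: p => *; rewrite /= cE. Qed.

Lemma chd_icode x : (chd (icode x) == 0) = (if x is inl _ then true else false).
Proof. by case: x => [i|p] /=; rewrite ?cE ?chd_pcode. Qed.

Lemma call_nodesP I : call_nodes (icodes I) -> exists gs, I = map inr gs.
Proof.
rewrite /call_nodes cfoldr_code; elim: I => [|x I ih] /=; first by exists [::].
move: ih; case: (foldr _ _ _) => [|[|n]] //= /(_ isT)[gs ->].
by rewrite chd_icode; case: x => // p _; exists (p :: gs).
Qed.

Lemma call_nodes_progs gs : call_nodes (icodes (map inr gs)).
Proof.
rewrite /call_nodes cfoldr_code; elim: gs => //= g gs /eqP->.
by rewrite chd_pcode.
Qed.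

Lemma icodes_eq0 I : (icodes I == 0) = (I == [::]).
Proof. by case: I => // x I; rewrite map_cons ccode_cons cE. Qed.

Lemma iencs_progs gs :
  iencs (map inr gs) = flatten (map (@GenTree.encode nat) (map prog_enc gs)).
Proof. by rewrite /iencs -!map_comp. Qed.

Lemma icodes_progs gs : icodes (map inr gs) = ccode (map pcode gs).
Proof. by rewrite -map_comp. Qed.

Lemma cwf_prog n I : cwf n (icodes I) ->
  exists2 p, pcode p = ccons n.+1 (icodes I)
           & GenTree.encode (prog_enc p) = inl n.+1 :: rcons (iencs I) (inl 0).
Proof.
have nil J : ccode (map icode J) == 0 -> J = [::] by rewrite icodes_eq0 => /eqP.
case: n => [|[|[|[|[|[|[|n]]]]]]]; rewrite /cwf /= ?orbF.
- by move/nil->; exists PZero.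
- by move/nil->; exists PSucc.
- case: I => [|x I] /eqP; first by move/esym/eqP; rewrite cE.
  rewrite map_cons ccode_cons => /ccons_inj[e1 /eqP/nil->].
  case: x e1 => [i|p] /= e; first by exists (PProj i).
  by have:= chd_pcode p; rewrite e cE.
- by move/nil->; exists POracle.
- move=> /andP[I0 /call_nodesP[[|f gs] eI]]; first by rewrite eI in I0.
  exists (PComp f gs); rewrite eI.
    by rewrite icodes_progs.
  by rewrite iencs_progs.
- case: I => [|x [|y I]]; rewrite ?map_cons ?ccode_cons ?cE // !chd_icode.
    by rewrite andbF.
  case: x y => [i|f] [j|g] //= /nil->; exists (PPrec f g) => //.
- case: I => [|x I]; rewrite ?map_cons ?ccode_cons ?cE // chd_icode.
  by case: x => [i|f] //= /nil->; exists (PMu f).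
- by [].
Qed.

Lemma cwf_leaf i : cwf 2 (icodes [:: inl i]).
Proof. by rewrite /cwf /= !ccode_cons !cE eqxx. Qed.

Lemma parse_step_inr x L st :
  parse_step (pickle (inr x : nat + nat)) (ccons L st) = ccons (ccons (ccons 0 x) L) st.
Proof.
by rewrite pickle_inr /parse_step /uncinr /cinr !cE eqxx.
Qed.

Lemma parse_step_inl n st : st != 0 ->
  parse_step (pickle (inl n : nat + nat)) st =
  if n == 0 then ccons 0 st else
  if ctl st == 0 then 0 else
  if cwf n.-1 (chd st) then
    ccons (ccons (ccons n (chd st)) (chd (ctl st))) (ctl (ctl st)) else 0.
Proof.
move=> /negbTE st0; rewrite pickle_inl /parse_step /uncinr /uncinl st0.
have -> : (cinl n == cinr (chd (chd (ctl (cinl n))))) = false.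
  by apply/eqP => /ccons_inj[/eqP]; rewrite cE.
by rewrite /cinl !cE eqxx.
Qed.

Definition parses (x : item) := forall L st,
  foldr parse_step (ccons L st) (map pickle (ienc x)) = ccons (ccons (icode x) L) st.

Lemma parses_node n I L st : (forall x, List.In x I -> parses x) -> cwf n (icodes I) ->
  foldr parse_step (ccons L st)
    (map pickle (inl n.+1 :: rcons (iencs I) (inl 0) : seq (nat + nat))) =
  ccons (ccons (ccons n.+1 (icodes I)) L) st.
Proof.
move=> hI hwf; rewrite map_cons map_rcons /= foldr_rcons.
rewrite (@parse_step_inl 0) ?cE //=.
have -> : foldr parse_step (ccons 0 (ccons L st)) (map pickle (iencs I)) =
   ccons (icodes I) (ccons L st).
  elim: I hI {hwf} => //= x I ih hI; rewrite /iencs /= map_cat foldr_cat ih.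
    by rewrite hI //; left.
  by move=> y hy; apply: hI; right.
by rewrite (@parse_step_inl n.+1) ?cE // hwf.
Qed.

Fixpoint parses_prog (p : prog) : parses (inr p).
Proof.
move=> L st; case: p => [||i||f gs|f g|f].
- by apply: (@parses_node 0 [::]).
- by apply: (@parses_node 1 [::]).
- apply: (@parses_node 2 [:: inl i]); last exact: cwf_leaf.
  by move=> x [<-|//] L' st'; rewrite /= parse_step_inr.
- by apply: (@parses_node 3 [::]).
- have hgs : forall x, List.In x (map inr gs) -> parses x.
    elim: gs => //= g gs ih x [<-|]; last exact: ih.
    exact: parses_prog.
  have:= @parses_node 4 (map inr (f :: gs)) L st.
  rewrite iencs_progs icodes_progs; apply.
    by move=> x [<-|]; [exact: parses_prog | exact: hgs].
  by rewrite /cwf -icodes_progs icodes_eq0 call_nodes_progs.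
- have:= @parses_node 5 (map inr [:: f; g]) L st.
  rewrite iencs_progs icodes_progs /= !cats0; apply.
    by move=> x [<-|[<-|//]]; exact: parses_prog.
  by rewrite /cwf !ccode_cons !cE !chd_pcode.
- have:= @parses_node 6 (map inr [:: f]) L st.
  rewrite iencs_progs icodes_progs /= !cats0; apply.
    by move=> x [<-|//]; exact: parses_prog.
  by rewrite /cwf !ccode_cons !cE !chd_pcode.
Qed.

(** A nonzero state loses no information: unfolding its stack, with one end marker for each open
    list, gives back exactly the input read. Hence numbers that code no program are rejected. *)
Lemma parse_sound (s : seq nat) : foldr parse_step (ccons 0 0) s != 0 ->
  exists I stk, foldr parse_step (ccons 0 0) s =
      ccons (icodes I) (ccode [seq icodes J | J <- stk])
    /\ s = map pickle (iencs I ++ flatten [seq inl 0 :: iencs J | J <- stk]).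
Proof.
elim: s => [|t s ih] /=; first by exists [::], [::].
move: ih; case: eqP => [-> _|_ /(_ isT)[I [stk [-> ->]]]]; first by rewrite /parse_step.
rewrite /parse_step !cE.
case: (t =P cinr (uncinr t)) => [et _|_].
  exists (inl (uncinr t) :: I), stk; split=> //.
  by rewrite {1}et.
case: (t =P cinl (uncinl t)) => [et|//].
case: (uncinl t =P 0) => [et0 _|/eqP t0].
  exists [::], (I :: stk); split=> //=.
  by rewrite {1}et et0.
case: stk => [|J stk]; first by rewrite eqxx.
rewrite map_cons ccode_cons !cE.
case hwf: (cwf _ _) => // _.
have [p ep enp] := cwf_prog hwf; rewrite prednK ?lt0n // in ep enp.
exists (inr p :: J), stk; split; first by rewrite map_cons ccode_cons /= ep.
rewrite -[iencs (_ :: J)]/(GenTree.encode (prog_enc p) ++ iencs J) enp !cat_cons.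
by rewrite [RHS]map_cons pickle_inl -et -cats1 -!catA.
Qed.

Lemma validP e : reflect (exists p, code p = e) (valid e).
Proof.
apply: (iffP andP) => [[/eqP he hn]|[p <-]]; last first.
  rewrite /parsed /parse code_prog cfoldr_code (parses_prog p 0 0) !cE eqxx.
  by rewrite /= chd_pcode.
(* Every number is the code of some list, so [parse_sound] applies to any [e]. *)
have h3 : parse e = foldr parse_step (ccons 0 0) (CodeSeq.decode e).
  by rewrite /parse -cfoldr_code CodeSeq.decodeK.
have: parse e != 0 by rewrite he cE.
rewrite h3 => /parse_sound[I [stk [h1 h2]]].
have:= he; rewrite h3 h1 => /ccons_inj[e1 e2].
have stk0 : stk = [::].
  by case: stk e2 {h1 h2} => // J stk /eqP; rewrite map_cons ccode_cons cE.
case: I h1 h2 e1 => [|x I] h1 h2; first by move/esym/eqP; rewrite cE.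
rewrite map_cons ccode_cons => /ccons_inj[e3 /eqP]; rewrite icodes_eq0 => /eqP I0.
move: hn; rewrite -e3 chd_icode; case: x {h1 e3} h2 => // p h2 _.
exists p; rewrite code_prog -[e]CodeSeq.decodeK h2 I0 stk0 /iencs /=.
by rewrite !cats0.
Qed.

Lemma parsed_code p : parsed (code p) = pcode p.
Proof.
by rewrite /parsed /parse code_prog cfoldr_code (parses_prog p 0 0) !cE.
Qed.

(** * The stages of the halting set *)

(** Membership of [e] in the stage K_s; [ccons e 0] codes the argument list [[:: e]]. *)
Definition halts_by e s :=
  valid e && halted (iter s step (sEval (parsed e) (ccons e 0) 0)).

Lemma halting_setP e : halting_set e <-> exists s, halts_by e s.
Proof.
split=> [[p [<- /eval_haltedP[n hn]]]|[s /andP[/validP[p <-]]]].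
  exists n; rewrite /halts_by parsed_code -(ccode_cons _ [::]) hn andbT.
  by apply/validP; exists p.
rewrite parsed_code => h; exists p; split=> //.
by apply/eval_haltedP; exists s.
Qed.

Lemma halts_by_leq e s t : s <= t -> halts_by e s -> halts_by e t.
Proof. by move=> st /andP[h1 h2]; rewrite /halts_by h1 (halted_iter st h2). Qed.

Lemma recursive_halts_by A k F G : recursive A k F -> recursive A k G ->
  recursiveb A k (fun v => halts_by (F v) (G v)).
Proof.
move=> hF hG; rewrite /halts_by /halted.
have hi : recursive A k
    (fun v => iter (G v) step (sEval (parsed (F v)) (ccons (F v) 0) 0)).
  apply: (@eq_recursive _ _
    (fun v => iteri (G v) (fun _ => step) (sEval (parsed (F v)) (ccons (F v) 0) 0))).
    by move=> v _; elim: (G v) => //= n ->.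
  apply: (recursive_iteri (S := fun _ z _ => step z)) => //.
    by rewrite /sEval; rec => //; apply: recursive_parsed.
  by apply: recursive_step; rec.
by rec => //; apply: recursive_valid.
Qed.

(** * Distances between rationals, computed from their codes *)

(** Positive and negative parts of a coded integer, which keep the arithmetic within the natural
    numbers. The successor in [zneg] is there because [Negz n] is [- n.+1]. *)
Definition zpos c := chd (chd c).
Definition zneg c := if chd c == 0 then (uncinr c).+1 else 0.

Definition qpos c := zpos (chd c).
Definition qneg c := zneg (chd c).
Definition qden c := zpos (chd (ctl c)).

(* The integer part of [1 / (y - x)] for [a = qcode x] and [b = qcode y]; it is [0] when
   [y <= x], as the truncated difference, and then the quotient, is [0]. *)
Definition fineness a b :=
  (qden a * qden b) %/
  ((qpos b * qden a + qneg a * qden b) - (qneg b * qden a + qpos a * qden b)).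

Lemma recursive_fineness A k F G : recursive A k F -> recursive A k G ->
  recursive A k (fun v => fineness (F v) (G v)).
Proof.
apply: recursive_app2.
by rewrite /fineness /qpos /qneg /qden /zpos /zneg /uncinr; rec.
Qed.

Lemma pickle_int (z : int) :
  pickle z = match z with Posz n => cinl n | Negz n => cinr n end.
Proof. by case: z. Qed.

Lemma qcodeE q : qcode q = ccons (pickle (numq q)) (ccons (pickle (denq q)) 0).
Proof. by []. Qed.

Lemma zpos_zneg (z : int) : ((zpos (pickle z))%:Z - (zneg (pickle z))%:Z)%R = z.
Proof.
rewrite pickle_int /zpos /zneg /uncinr; case: z => n.
  by rewrite /cinl !cE subr0.
by rewrite /cinr !cE eqxx NegzE sub0r.
Qed.

Lemma qpos_qneg q : ((qpos (qcode q))%:Z - (qneg (qcode q))%:Z)%R = numq q.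
Proof. by rewrite /qpos /qneg qcodeE !cE zpos_zneg. Qed.

Lemma qden_denq q : (qden (qcode q))%:Z%R = denq q.
Proof.
rewrite /qden qcodeE !cE pickle_int; have:= denq_gt0 q.
by case: (denq q) => // n _; rewrite /zpos /cinl !cE.
Qed.

(** * The colouring and its computability *)

Definition changes m s t := [exists e : 'I_m, halts_by e s != halts_by e t].

Lemma changesP m s t :
  reflect (exists2 e, (e < m)%N & halts_by e s != halts_by e t) (changes m s t).
Proof.
apply: (iffP existsP) => [[e he]|[e em he]]; first by exists e.
by exists (Ordinal em).
Qed.

Lemma recursive_changes A k F G H : recursive A k F -> recursive A k G -> recursive A k H ->
  recursiveb A k (fun v => changes (F v) (G v) (H v)).
Proof.
move=> hF hG hH.
(* The existential becomes a loop over [e] whose accumulator turns to [1] at the first difference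
   and stays there. *)
pose T e z v := nat_of_bool ((z == 1) ||
  ~~ (halts_by e (nth 0 v 0) == halts_by e (nth 0 v 1) :> nat)).
have hT : recursive A 3 (fun v => iteri (nth 0 v 2) (fun e z => T e z v) 0).
  apply: recursive_iteri; rewrite /T; rec; apply: recursive_halts_by; rec.
case: hT => p hp; case: hF => f hf; case: hG => g hg; case: hH => h hh.
exists (PComp p [:: g; h; f]) => v hv.
apply: (@ev_comp _ _ _ _ [:: G v; H v; F v]).
  by repeat constructor; [apply: hg | apply: hh | apply: hf].
have := hp [:: G v; H v; F v] erefl; rewrite /=.
congr (eval _ _ _ _); elim: (F v) => [|m ih] /=.
  by case: changesP => // -[].
rewrite ih {1}/T /=; congr nat_of_bool.
apply/idP/changesP => [/orP[]|[e]].
- rewrite eqb1 => /changesP[e em he]; exists e => //; exact: leqW.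
- by move=> he; exists m => //; apply: contra he => /eqP->.
- rewrite ltnS leq_eqVlt => /orP[/eqP-> he|em he].
    by apply/orP; right; move: he; do 2!case: (halts_by _ _).
  by apply/orP; left; rewrite eqb1; apply/changesP; exists e.
Qed.

Section Rationals.
Local Open Scope ring_scope.

Lemma leq_fineness n x y :
  (n < fineness (qcode x) (qcode y))%N = (x < y) && ((y - x) * n.+1%:R <= 1).
Proof.
have px := qpos_qneg x; have py := qpos_qneg y.
have dx := qden_denq x; have dy := qden_denq y.
rewrite /fineness; move: px py dx dy.
move: (qpos (qcode x)) (qneg (qcode x)) (qden (qcode x)).
move: (qpos (qcode y)) (qneg (qcode y)) (qden (qcode y)).
move=> b b' e a a' d px py dx dy.
have d0 : (0 < d)%N by have:= denq_gt0 x; rewrite -dx.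
have e0 : (0 < e)%N by have:= denq_gt0 y; rewrite -dy.
have ex : x = (a%:R - a'%:R) / d%:R.
  by rewrite -[x]divq_num_den -px -dx rmorphB.
have ey : y = (b%:R - b'%:R) / e%:R.
  by rewrite -[y]divq_num_den -py -dy rmorphB.
have d0' : (0 : rat) < d%:R by rewrite ltr0n.
have e0' : (0 : rat) < e%:R by rewrite ltr0n.
(* Over the common denominator [d * e], the distance is a difference of two natural numbers, the one
   that [fineness] divides by. *)
have gap : (y - x) * (d * e)%:R = (b * d + a' * e)%:R - (b' * d + a * e)%:R.
  rewrite ex ey !natrD !natrM; field.
  by rewrite !lt0r_neq0.
have de0 : (0 : rat) < (d * e)%:R by rewrite natrM mulr_gt0.
rewrite -subr_gt0 -(pmulr_lgt0 _ de0) gap subr_gt0 ltr_nat.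
case: (ltnP (b' * d + a * e)) => [h|h]; last by rewrite (eqP (etrans (subn_eq0 _ _) h)) divn0.
rewrite leq_divRL ?subn_gt0 // -(ler_pM2r de0) mul1r -mulrAC gap -natrB ?(ltnW h) //.
by rewrite -natrM ler_nat mulnC.
Qed.

Definition colour (x y : rat) : 'I_4 :=
  inord (2 * (qcode x < qcode y)
         + changes (fineness (qcode x) (qcode y)) (qcode x) (qcode y))%N.

Lemma val_colour x y :
  colour x y = (2 * (qcode x < qcode y)
         + changes (fineness (qcode x) (qcode y)) (qcode x) (qcode y))%N :> nat.
Proof. by rewrite inordK //; case: (qcode x < qcode y)%N; case: changes. Qed.

Lemma computable_colour : computable_coloring2 colour.
Proof.
have: recursive2 no_oracle (fun a b => 2 * (a < b)%N + changes (fineness a b) a b)%N.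
  by rec; apply: recursive_changes; rec; apply: recursive_fineness; rec.
by case=> p hp; exists p => x y _; rewrite val_colour; apply: (hp [:: _; _]).
Qed.

(** * Dense sets on which the second bit is constant *)

Section Solutions.
Variable S : pred rat.
Hypothesis denseS : dense_no_endpoints S.

(** The interval contains [N.+2] points of [S], and only [N.+1] codes are at most [N]. *)
Lemma dense_qcode_gt N x y : S x -> S y -> x < y ->
  exists z, [/\ S z, x < z, z < y & (N < qcode z)%N].
Proof.
move=> Sx Sy xy.
have many k : exists l : seq rat,
    [/\ size l = k, uniq l & forall z, z \in l -> [/\ S z, x < z & z < y]].
  elim: k y Sy xy => [|k ih] y Sy xy; first by exists [::].
  have [_ dense _] := denseS; have [z [Sz xz zy]] := dense x y Sx Sy xy.
  have [l [sl ul hl]] := ih z Sz xz; exists (z :: l); split=> /=.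
  - by rewrite sl.
  - by rewrite ul andbT; apply/negP => /hl[]; rewrite ltxx.
  - move=> t; rewrite inE => /orP[/eqP->//|/hl[St xt tz]].
    by split=> //; apply: lt_trans zy.
have [l [sl ul hl]] := many N.+2.
have [/hasP[z zl hz]|/hasPn h] := boolP (has (fun z => N < qcode z)%N l).
  by have [Sz xz zy] := hl z zl; exists z.
have: (size (map qcode l) <= size (iota 0 N.+1))%N.
  apply: uniq_leq_size; first by rewrite map_inj_uniq //; apply: pcan_inj pickleK.
  by move=> _ /mapP[z /h zl ->]; rewrite mem_iota /= add0n ltnS leqNgt.
by rewrite size_map size_iota sl ltnn.
Qed.

Lemma dense_fineness_gt n :
  exists x y, [/\ S x, S y & (n < fineness (qcode x) (qcode y))%N].
Proof.
have [[a Sa] dense noend] := denseS; have [_ [b [_ Sb _ ab]]] := noend a Sa.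
have close k : exists x y, [/\ S x, S y, x < y & (y - x) * 2 ^+ k <= b - a].
  elim: k => [|k [x [y [Sx Sy xy h]]]]; first by exists a, b; rewrite expr0 mulr1.
  have [z [Sz xz zy]] := dense x y Sx Sy xy.
  have p0 : (0 : rat) < 2 ^+ k by rewrite exprn_gt0.
  (* The point [z] may lie anywhere in the interval, but the shorter piece has at most half the
     length. *)
  have [h1|h1] := lerP (z - x) (y - z).
    exists x, z; split=> //; rewrite exprS; move: p0 h; move: (2 ^+ k) => p p0 h; nra.
  exists z, y; split=> //; rewrite exprS; move: p0 h; move: (2 ^+ k) => p p0 h; nra.
have [k hk] : exists k, (b - a) * n.+1%:R <= 2 ^+ k.
  have := archi_boundP (_ : 0 <= (b - a) * n.+1%:R).
  set N := Num.bound _ => hN; exists N; apply: le_trans (ltW (hN _)) _.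
    by rewrite mulr_ge0 ?ler0n // subr_ge0 ltW.
  by rewrite -natrX ler_nat ltnW // ltn_expl.
have [x [y [Sx Sy xy h]]] := close k; exists x, y; split=> //.
rewrite leq_fineness xy /=.
have p0 : (0 : rat) < 2 ^+ k by rewrite exprn_gt0.
rewrite -(ler_pM2r p0) mul1r mulrAC; apply: le_trans hk.
by rewrite ler_wpM2r ?ler0n.
Qed.

(** Each number below [m] enters the stages at most once. Whether it ever does cannot be decided
    constructively, hence the double negation; the lemma is only used to derive a contradiction. *)
Lemma eventually_stable m :
  ~ ~ exists s, forall t t', (s <= t)%N -> (s <= t')%N -> ~~ changes m t t'.
Proof.
elim: m => [|m ih] no.
  by apply: no; exists 0%N => t t' _ _; apply/changesP => -[].
apply: ih => -[s hs].
suff key r : ((s <= r)%N /\ forall t t', (r <= t)%N -> (r <= t')%N ->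
    halts_by m t = halts_by m t') -> False.
  (* If [m] never enters, [s] itself works. If it has entered by [t], its status is constant from
     [maxn s t] on, and [key] applies there. *)
  apply: (key s); split=> // t t' st st'.
  apply/idP/idP => h; apply/negPn/negP => _.
    apply: (key (maxn s t)); split=> [|u u']; first exact: leq_maxl.
    rewrite !geq_max => /andP[_ /halts_by_leq->//] /andP[_ /halts_by_leq->//].
  apply: (key (maxn s t')); split=> [|u u']; first exact: leq_maxl.
  by rewrite !geq_max => /andP[_ /halts_by_leq->//] /andP[_ /halts_by_leq->//].
move=> [sr hr]; apply: no; exists r => t t' rt rt'.
apply/changesP => -[e]; rewrite ltnS leq_eqVlt => /orP[/eqP->|em].
  by rewrite (hr t t') ?eqxx.
move=> he; have:= hs t t' (leq_trans sr rt) (leq_trans sr rt').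
by move/changesP; apply; exists e.
Qed.

Lemma not_always_changes (sg : bool) :
  (forall x y, S x -> S y -> x < y -> (qcode x < qcode y)%N = sg ->
    changes (fineness (qcode x) (qcode y)) (qcode x) (qcode y)) -> False.
Proof.
move=> h; have [[b Sb] _ noend] := denseS.
have [a [c [Sa Sc ab bc]]] := noend b Sb.
have [_ [d [_ Sd _ cd]]] := noend c Sc.
apply: (@eventually_stable (fineness (qcode b) (qcode c))) => -[s hs].
have key x y : S x -> S y -> x < b -> c < y -> (s <= qcode x)%N -> (s <= qcode y)%N ->
    (qcode x < qcode y)%N <> sg.
  move=> Sx Sy xb cy sx sy esg.
  have xy : x < y by apply: lt_trans xb (lt_trans bc cy).
  have /changesP[e he hne] := h x y Sx Sy xy esg.
  have /changesP[] := hs _ _ sx sy; exists e => //.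
  (* The wider interval has the smaller fineness, so [e] is also below the fineness of [b] and
     [c]. *)
  move: he; rewrite !leq_fineness bc xy /= => hle; apply: le_trans hle.
  by rewrite ler_pM2r ?ltr0Sn //; lra.
(* Codes increase from [x] to [y] to [x'], while [x] and [x'] lie left of [b] and [y] right of [c].
   The pairs [x], [y] and [x'], [y] thus realise both values of the first bit, one of which is
   [sg]. *)
have [x [Sx _ xb sx]] := dense_qcode_gt s Sa Sb ab.
have [y [Sy cy _ xy]] := dense_qcode_gt (qcode x) Sc Sd cd.
have [x' [Sx' _ xb' yx]] := dense_qcode_gt (qcode y) Sa Sb ab.
have := key x y Sx Sy xb cy (ltnW sx) (ltnW (ltn_trans sx xy)).
have := key x' y Sx' Sy xb' cy
  (ltnW (ltn_trans (ltn_trans sx xy) yx)) (ltnW (ltn_trans sx xy)).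
by rewrite xy ltnNge (ltnW yx); case: sg {h key}.
Qed.

Local Notation A := (rat_set_oracle S).

Lemma oracleP a : reflect (exists2 q, S q & qcode q = a) (A a).
Proof.
rewrite /rat_set_oracle; apply: (iffP idP) => [|[q Sq <-]]; last first.
  by rewrite pickleK_inv.
by have:= @pickle_invK rat a; case: (pickle_inv a) => //= q <- Sq; exists q.
Qed.

Lemma never_changes_computes (sg : bool) :
  (forall x y, S x -> S y -> x < y -> (qcode x < qcode y)%N = sg ->
    ~~ changes (fineness (qcode x) (qcode y)) (qcode x) (qcode y)) ->
  turing_computes A halting_set.
Proof.
move=> h.
pose R z n := [&& A (chd z), A (ctl z) & (n < fineness (chd z) (ctl z))%N].
have exR n : exists z, R z n.
  have [x [y [Sx Sy xy]]] := dense_fineness_gt n.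
  exists (ccons (qcode x) (qcode y)); rewrite /R !cE xy andbT.
  by apply/andP; split; apply/oracleP; [exists x | exists y].
(* The search runs over pairs of codes, packed by [ccons]; it always succeeds since [S] has
   arbitrarily close points. *)
pose G n := ex_minn (exR n).
have RG n : R (G n) n by rewrite /G; case: ex_minnP.
have recG : recursive1 A G.
  apply: (recursive_mu (R := fun z v => R z (nth 0%N v 0%N))).
    rewrite /R; apply: recursiveb_and; first by apply: recursive_oracle; rec.
    apply: recursiveb_and; first by apply: recursive_oracle; rec.
    by apply: recursiveb_leq; rec; apply: recursive_fineness; rec.
  move=> v _; split=> // m; rewrite /G; case: ex_minnP => z _ hz hm.
  by apply/negP => /hz; rewrite leqNgt hm.
(* A point [z] of large code between the endpoints [x] and [y] gives first bit true with [x] and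
   false with [y], so the hypothesis concerns the endpoint selected here. *)
pose stage n := if sg then chd (G n) else ctl (G n).
have [p hp] : recursiveb A 1 (fun v => halts_by (nth 0 v 0) (stage (nth 0 v 0)))%N.
  rewrite /stage; case: (sg); apply: recursive_halts_by; rec; exact: recG.
have stageP n : halting_set n -> halts_by n (stage n).
  move=> /halting_setP[s hs].
  have /and3P[/oracleP[x Sx ex] /oracleP[y Sy ey]] := RG n.
  rewrite -ex -ey leq_fineness => /andP[xy hxy].
  (* The code of [z] is past the stage [s] at which [n] has entered and past both endpoints.
     Agreement between [z] and the selected endpoint then carries membership of [n] back to
     [stage n]. *)
  have [z [Sz xz zy hz]] := dense_qcode_gt (maxn s (maxn (qcode x) (qcode y))) Sx Sy xy.
  move: hz; rewrite !gtn_max => /and3P[sz hzx hzy].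
  have hn := halts_by_leq (ltnW sz) hs.
  rewrite /stage -ex -ey; apply/negPn/negP; case esg: (sg) => hno.
    have /changesP[] := h x z Sx Sz xz (etrans hzx (esym esg)); exists n.
      rewrite leq_fineness xz /=; apply: le_trans hxy.
      by rewrite ler_pM2r ?ltr0Sn //; lra.
    by rewrite (negbTE hno) hn.
  have /changesP[] := h z y Sz Sy zy (etrans (leq_gtF (ltnW hzy)) (esym esg)).
  exists n.
    rewrite leq_fineness zy /=; apply: le_trans hxy.
    by rewrite ler_pM2r ?ltr0Sn //; lra.
  by rewrite (negbTE hno) hn.
exists p => n; have ev := hp [:: n] erefl; rewrite /= in ev; split=> hn.
  by rewrite stageP in ev.
move: ev; case hb: (halts_by n _) => //.
by case: hn; apply/halting_setP; exists (stage n).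
Qed.

End Solutions.

End Rationals.

Theorem theorem5p26 :
  exists f : coloring2 4,
    computable_coloring2 f /\
    forall S : pred rat, DT2_solution 3 f S ->
      turing_computes (rat_set_oracle S) halting_set.
Proof.
exists colour; split=> [|S [denseS [C [C3 hC]]]]; first exact: computable_colour.
have /subsetPn[c _ cC] : ~~ ([set: 'I_4] \subset C).
  by apply: contraL C3 => /subset_leq_card; rewrite cardsT card_ord -ltnNge.
(* The two bits of the omitted colour. *)
have val : c = (2 * (1 < c) + odd c)%N :> nat by case: c {cC} => -[|[|[|[|]]]].
have miss x y : S x -> S y -> (x < y)%R -> (qcode x < qcode y)%N = (1 < c)%N ->
    changes (fineness (qcode x) (qcode y)) (qcode x) (qcode y) != odd c.
  move=> Sx Sy xy e; apply: contra cC => /eqP e'.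
  have <- : colour x y = c by apply/val_inj; rewrite /= val_colour e e' -val.
  exact: hC.
(* Among pairs whose first bit is that of [c], the second bit is always the opposite of [odd c]. *)
case co: (odd c) in miss.
  apply: (never_changes_computes denseS (sg := (1 < c)%N)) => x y Sx Sy xy /miss.
  by move=> /(_ Sx Sy xy); case: changes.
case: (not_always_changes denseS (sg := (1 < c)%N)) => x y Sx Sy xy /miss.
by move=> /(_ Sx Sy xy); case: changes.
Qed.
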